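(* For every function $r\colon\mathbb{N}\to\mathbb{R}_{>0}$ with $\lim_{t\to\infty} r_t/t=0$, there exist mutually absolutely continuous CDFs $F_-$ and $F_+$ yielding unbounded signals such that, in the social learning model with these signal distributions, $$\liminf_{t\to\infty}\frac{|\ell_t|}{r_t}>0$$ with probability $1$.
   Context: Social learning model. A state $\theta\in\{-1,+1\}$ is drawn with $\mathbb{P}(\theta=+1)=\mathbb{P}(\theta=-1)=1/2$. Agents $t=1,2,\dots$ receive private signals $s_t\in\mathbb{R}$ that are i.i.d. conditionally on $\theta$, with CDF $F_+$ if $\theta=+1$ and $F_-$ if $\theta=-1$; $F_+$ and $F_-$ are mutually absolutely continuous. Let $L_t=\log\frac{\mathbb{P}(\theta=+1\mid s_t)}{\mathbb{P}(\theta=-1\mid s_t)}$ be the private log-likelihood ratio, and let $G_+$, $G_-$ denote the CDFs of $L_t$ conditional on $\theta=+1$, $\theta=-1$ respectively. Signals are assumed unbounded: for every $M\in\mathbb{R}$, $\mathbb{P}(L_t>M)>0$ and $\mathbb{P}(L_t<-M)>0$. Agent $t$ observes $a_1,\dots,a_{t-1}$ and her own signal and chooses $a_t\in\{-1,+1\}$ (utility $1$ if $a_t=\theta$, else $0$). The public belief is $\mu_t=\mathbb{P}(\theta=+1\mid a_1,\dots,a_{t-1})$ and $\ell_t=\log\frac{\mu_t}{1-\mu_t}$ (so $\ell_1=0$). In equilibrium $a_t=+1$ iff $\ell_t+L_t>0$, and otherwise $a_t=-1$. Consequently $\ell_{t+1}=\ell_t+D_+(\ell_t)$ if $a_t=+1$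 and $\ell_{t+1}=\ell_t+D_-(\ell_t)$ if $a_t=-1$, where $D_+(x)=\log\frac{1-G_+(-x)}{1-G_-(-x)}$ and $D_-(x)=\log\frac{G_+(-x)}{G_-(-x)}$. We write $\mathbb{P}_+(\cdot)=\mathbb{P}(\cdot\mid\theta=+1)$ and $\mathbb{E}_+$ for the corresponding expectation. *)

(* Defs.v *)
From HB Require Import structures.
From mathcomp Require Import all_boot all_order all_algebra.
From mathcomp Require Import all_classical all_reals all_analysis.
Set Implicit Arguments. Unset Strict Implicit. Unset Printing Implicit Defensive.
Import Order.TTheory GRing.Theory Num.Theory.
Import numFieldNormedType.Exports.
Local Open Scope classical_set_scope.
Local Open Scope ring_scope.

Section SocialLearning.
Variable R : realType.

(* The signal distributions are given by Borel probability measures on R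
   (equivalently, by their CDFs F_+(x) = mup `]-oo, x]`, F_-(x) = mum `]-oo, x]`). *)

Definition mutually_ac (mup mum : probability R R) : Prop :=
  forall A : set R, measurable A -> (mup A = 0%E <-> mum A = 0%E).

(* h is a version of the private log-likelihood ratio
   L(s) = log P(theta=+1|s)/P(theta=-1|s) = log (dF_+/dF_-)(s)
   (uniform prior): exp h is a density of mup with respect to mum. *)
Definition is_llr (mup mum : probability R R) (h : R -> R) : Prop :=
  measurable_fun setT h /\
  forall A : set R, measurable A ->
    mup A = (\int[mum]_(x in A) (expR (h x))%:E)%E.

(* Unbounded signals: for every M, P(L > M) > 0 and P(L < -M) > 0,
   where P = (mup + mum)/2 is the unconditional law of the signal. *)
Definition unbounded_signals (mup mum : probability R R) (h : R -> R) : Prop :=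
  forall M : R,
    (0 < mup [set y | (M < h y)%R] + mum [set y | (M < h y)%R])%E /\
    (0 < mup [set y | (h y < - M)%R] + mum [set y | (h y < - M)%R])%E.

Definition Gp (mup : probability R R) (h : R -> R) (x : R) : R :=
  fine (mup [set y | h y <= x]).
Definition Gm (mum : probability R R) (h : R -> R) (x : R) : R :=
  fine (mum [set y | h y <= x]).

Definition Dp (mup mum : probability R R) (h : R -> R) (x : R) : R :=
  ln ((1 - Gp mup h (- x)) / (1 - Gm mum h (- x))).
Definition Dm (mup mum : probability R R) (h : R -> R) (x : R) : R :=
  ln (Gp mup h (- x) / Gm mum h (- x)).

(* Public log-likelihood ratio, 0-based: pub_llr t = ell_{t+1}, driven by the
   signal sequence sig where sig t = s_{t+1}.  ell_1 = 0, and agent t acts +1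
   iff ell_t + L_t > 0, after which ell_{t+1} = ell_t + D_{a_t}(ell_t). *)
Fixpoint pub_llr (mup mum : probability R R) (h : R -> R) (sig : nat -> R)
    (t : nat) : R :=
  match t with
  | 0%N => 0
  | t'.+1 =>
      let l := pub_llr mup mum h sig t' in
      if 0 < l + h (sig t') then l + Dp mup mum h l else l + Dm mup mum h l
  end.

(* The model: theta (true <-> theta = +1) and signals s t (= s_{t+1}) on a
   probability space, with P(theta=+1)=P(theta=-1)=1/2 and, conditionally on
   theta, the signals i.i.d. with law mup resp. mum.  This is expressed through
   the finite-dimensional joint laws. *)
Definition social_model (mup mum : probability R R)
    (d : measure_display) (Omega : measurableType d) (P : probability Omega R)
    (theta : Omega -> bool) (s : nat -> Omega -> R) : Prop :=
  measurable [set w | theta w] /\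
  (forall t, measurable_fun setT (s t)) /\
  (forall (n : nat) (A : nat -> set R), (forall i, measurable (A i)) ->
     P ([set w | theta w] `&` \bigcap_(i in `I_n) (s i @^-1` A i)) =
       ((2^-1)%:E * \big[*%E/1%E]_(i < n) mup (A i))%E /\
     P ([set w | ~~ theta w] `&` \bigcap_(i in `I_n) (s i @^-1` A i)) =
       ((2^-1)%:E * \big[*%E/1%E]_(i < n) mum (A i))%E).

End SocialLearning.

(* Main.v *)
Require Import Defs.
From HB Require Import structures.
From mathcomp Require Import all_boot all_order all_algebra.
From mathcomp Require Import all_classical all_reals all_analysis.
From mathcomp Require Import measurable_realfun zify lra ring.
Import Order.TTheory GRing.Theory Num.Theory.
Import numFieldNormedType.Exports.
Local Open Scope classical_set_scope.
Local Open Scope ring_scope.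

(** The signals take the values [x k] and [- x k] with total weight [2^-(k+1)]
    at level [k], and the log-likelihood ratio of a signal is its value.  Below
    level [k], i.e. when [|l| < x k], the laws of the action under the two states
    differ by at least [2^-(k+3)], so each correct action then moves the belief
    by at least that much; since [r] is sublinear, making [x] grow fast enough
    yields [|l_t| >= r_t / 2] as soon as all later actions are correct.

    That errors stop almost surely follows from Borel-Cantelli.  Under the high
    state [V(l) = exp(-l/2)] is a Lyapunov function: its expected relative
    decrease in one step is the Hellinger deficit of the action law, at least
    [4^-(k+3) / 8], while the probability of an error is at most
    [V(l) exp(-|l|/2)].  As [x k >= 4k + 1], the latter is at most a constant
    times the expected decrease of [V], so the error probabilities are summable.
    The low state is symmetric. *)

(** * The signal distributions *)

Section SignalLaws.
Set Implicit Arguments.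
Unset Strict Implicit.
Variables (R : realType) (x : nat -> R).

Definition logistic (z : R) : R := (1 + expR (- z))^-1.

Lemma logistic_gt0 z : 0 < logistic z.
Proof. by rewrite invr_gt0 addr_gt0 ?expR_gt0. Qed.

Lemma logisticN z : logistic z + logistic (- z) = 1.
Proof.
rewrite /logistic opprK expRN.
have := expR_gt0 z; move: (expR z) => e e0.
field; rewrite !gt_eqF//; lra.
Qed.

Lemma logistic_ratio z : logistic z = expR z * logistic (- z).
Proof.
rewrite /logistic opprK expRN.
have := expR_gt0 z; move: (expR z) => e e0.
field; rewrite !gt_eqF//; lra.
Qed.

Lemma logistic_ge_half z : 0 <= z -> 2^-1 <= logistic z.
Proof.
move=> z0; rewrite /logistic lef_pV2 ?posrE ?addr_gt0 ?expR_gt0//.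
by rewrite -[2%:R]/(1 + 1 :> R) lerD2l expR_le1 oppr_le0.
Qed.

Definition logistic_nng z : {nonneg R} := NngNum (ltW (logistic_gt0 z)).

Lemma half_pow_ge0 n : 0 <= (2 ^- n.+1 : R).
Proof. by rewrite invr_ge0 exprn_ge0. Qed.

Definition half_pow_nng n : {nonneg R} := NngNum (half_pow_ge0 n).

(** The parameter [a] is the state, [1] or [-1]. Changing its sign swaps the weights of [x k] and
    [- x k], whose quotient is exponential, so that one state has density [expR (a * y)] against the
    other at a value [y]. Keeping [a] general lets one proof serve both states. *)
Definition pair_law (a : R) (k : nat) : {measure set R -> \bar R} :=
  mscale (half_pow_nng k)
    (measure_add (mscale (logistic_nng (a * x k)) \d_(x k))
                 (mscale (logistic_nng (- (a * x k))) \d_(- x k))).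

Definition signal_law (a : R) : set R -> \bar R := mseries (pair_law a) 0.

HB.instance Definition _ a := Measure.on (signal_law a).

Lemma pair_lawE a k A :
  pair_law a k A = ((2 ^- k.+1)%:E * ((logistic (a * x k))%:E * dirac (x k) A +
                    (logistic (- (a * x k)))%:E * dirac (- x k)%R A))%E.
Proof.
rewrite /pair_law/= /mscale/= /measure_add/= /msum.
by rewrite 2!big_ord_recl big_ord0 adde0.
Qed.

Lemma signal_law_setT a : signal_law a setT = 1%E.
Proof.
rewrite /signal_law /mseries.
under eq_eseriesr do
  rewrite pair_lawE !diracT !mule1 -EFinD logisticN mule1.
have := @cvg_geometric_series_half R 1 0; rewrite {1}/series/= expr0 divr1.
under eq_fun do under eq_bigr do rewrite addn1 div1r natrX.
move=> c; apply/cvg_lim => //.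
under eq_fun do rewrite sumEFin.
by apply/cvg_EFin => //; exact: nearW.
Qed.

HB.instance Definition _ a := Measure_isProbability.Build _ _ _
  (signal_law a) (signal_law_setT a).

(** The integral splits over the levels and their two atoms, and at each atom the identity is
    [logistic_ratio]. *)
Lemma signal_law_density a A : measurable A ->
  signal_law a A = (\int[signal_law (- a)]_(y in A) (expR (a * y))%:E)%E.
Proof.
move=> mA.
have mf : measurable_fun A (EFin \o (fun y : R => expR (a * y))).
  apply/measurable_EFinP; apply: measurable_funTS.
  by apply: measurableT_comp => //; exact: measurable_funM.
have f0 y : A y -> (0 <= (expR (a * y))%:E)%E by rewrite lee_fin expR_ge0.
rewrite ge0_integral_measure_series//; apply: eq_eseriesr => k _.
rewrite pair_lawE ge0_integral_mscale// ge0_integral_measure_add//.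
rewrite !ge0_integral_mscale// !integral_dirac//=.
rewrite mulNr opprK mulrN [in LHS](logistic_ratio (a * x k)).
rewrite [X in (_ + X%:E * _)%E]logistic_ratio opprK !EFinM.
by congr (_ * (_ + _))%E;
  rewrite [X in (X * _ = _)%E]muleC -muleA [X in (_ * X = _)%E]muleC.
Qed.

Lemma signal_law_mutually_ac a : mutually_ac (signal_law a) (signal_law (- a)).
Proof.
move=> A mA.
have mf b : measurable_fun A (EFin \o (fun y : R => expR (b * y))).
  apply/measurable_EFinP; apply: measurable_funTS.
  by apply: measurableT_comp => //; exact: measurable_funM.
split=> A0.
  apply: etrans (signal_law_density (- a) mA) _.
  by apply: null_set_integral => //; [exact: mf|rewrite opprK].
by apply: etrans (signal_law_density a mA) _; apply: null_set_integral => //; exact: mf.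
Qed.

Lemma signal_law_llr : is_llr (signal_law 1) (signal_law (- 1)) id.
Proof.
split=> // A mA; apply: etrans (signal_law_density 1 mA) _.
by under eq_integral do rewrite mul1r.
Qed.

(** The sign condition selects the atom favoured by the state, whose logistic weight is at least 1/2
    of the level weight [2 ^- k.+1]. Different levels may share a value, hence a bound and not an
    equality. *)
Lemma signal_law_atom_ge a k (y : R) : y = x k \/ y = - x k -> 0 <= a * y ->
  ((2 ^- k.+2)%:E <= signal_law a [set y])%E.
Proof.
move=> yk ay.
apply: (@le_trans _ _ (pair_law a k [set y])); last first.
  have h := @nneseries_lim_ge R (fun k => pair_law a k [set y]) xpredT 0%N k.+1.
  have {}h := h (fun _ _ _ => measure_ge0 _ _).
  apply: le_trans h; rewrite big_nat_recr//= leeDr//.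
  by apply: sume_ge0.
rewrite pair_lawE exprS invfM mulrC EFinM lee_wpmul2l ?lee_fin ?half_pow_ge0//.
have half : 2^-1 <= logistic (a * y) by apply: logistic_ge_half.
have p0 z b : 0 <= logistic z * \1_[set y] b.
  by rewrite mulr_ge0// ltW// logistic_gt0.
case: yk => yk; rewrite -?mulrN -yk.
  by rewrite ler_wpDr// indicE mem_set//= mulr1.
by rewrite ler_wpDl// indicE mem_set//= mulr1.
Qed.

End SignalLaws.

(** * Tails of the log-likelihood ratio *)

Section LogLikelihoodRatio.
Set Implicit Arguments.
Unset Strict Implicit.
Variables (R : realType) (mup mum : probability R R) (h : R -> R).
Hypothesis h_llr : is_llr mup mum h.

Let mh : measurable_fun setT h := h_llr.1.

Lemma fine_prob_le1 (mu : probability R R) A : measurable A -> fine (mu A) <= 1.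
Proof.
by move=> mA; rewrite -lee_fin fineK ?probability_le1// fin_num_measure.
Qed.

Lemma fine_prob_ge0 (mu : probability R R) A : 0 <= fine (mu A).
Proof. exact: fine_ge0. Qed.

Lemma fine_probC (mu : probability R R) A : measurable A ->
  fine (mu (~` A)) = 1 - fine (mu A).
Proof. by move=> mA; rewrite probability_setC// fineB// fin_num_measure. Qed.

Lemma fine_probD1 (mu : probability R R) A (a : R) : measurable A -> A a ->
  fine (mu A) = fine (mu [set a]) + fine (mu (A `\ a)).
Proof.
move=> mA Aa; rewrite -[in LHS](setD1K Aa) measureU//.
- by rewrite fineD// fin_num_measure//; exact: measurableD.
- exact: measurableD.
- by apply/seteqP; split=> y //= [-> []].
Qed.

Lemma measurable_llr_le c : measurable [set y | h y <= c].
Proof.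
rewrite (_ : [set y | _] = setT `&` h @^-1` `]-oo, c]); first exact: mh.
by rewrite setTI; apply/seteqP; split=> y /=; rewrite in_itv.
Qed.

Lemma measurable_llr_lt c : measurable [set y | h y < c].
Proof.
rewrite (_ : [set y | _] = setT `&` h @^-1` `]-oo, c[); first exact: mh.
by rewrite setTI; apply/seteqP; split=> y /=; rewrite in_itv.
Qed.

Lemma measurable_exp_llr A :
  measurable_fun A (EFin \o (fun y : R => expR (h y))).
Proof.
apply: measurable_funTS; apply/measurable_EFinP; exact: measurableT_comp.
Qed.

Lemma llr_le c A : measurable A -> (forall y, A y -> h y <= c) ->
  fine (mup A) <= expR c * fine (mum A).
Proof.
move=> mA Ac; rewrite -lee_fin EFinM !fineK ?fin_num_measure//.
rewrite h_llr.2// -integral_cst//; apply: ge0_le_integral => //.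
- exact: measurable_exp_llr.
- by move=> y Ay; rewrite lee_fin ler_expR Ac.
Qed.

Lemma llr_ge c A : measurable A -> (forall y, A y -> c <= h y) ->
  expR c * fine (mum A) <= fine (mup A).
Proof.
move=> mA Ac; rewrite -lee_fin EFinM !fineK ?fin_num_measure//.
rewrite h_llr.2// -integral_cst//; apply: ge0_le_integral => //.
- by move=> y Ay; rewrite lee_fin expR_ge0.
- exact: measurable_exp_llr.
- by move=> y Ay; rewrite lee_fin ler_expR Ac.
Qed.

Lemma llr_atom a : fine (mup [set a]) = expR (h a) * fine (mum [set a]).
Proof.
by apply/eqP; rewrite eq_le llr_le ?llr_ge// => y /= ->.
Qed.

(** Off the atom the density is at most 1 as well, so the rest of [A] contributes a nonnegative
    amount and the atom alone yields the bound. *)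
Lemma llr_gap_le0 A a : measurable A -> A a -> (forall y, A y -> h y <= 0) ->
  fine (mum [set a]) * (1 - expR (h a)) <= fine (mum A) - fine (mup A).
Proof.
move=> mA Aa A0; rewrite !(fine_probD1 _ mA Aa) llr_atom.
have mD : measurable (A `\ a) by exact: measurableD.
have : fine (mup (A `\ a)) <= expR 0 * fine (mum (A `\ a)).
  by apply: llr_le => // y [/A0].
rewrite expR0; lra.
Qed.

Lemma llr_gap_ge0 A a : measurable A -> A a -> (forall y, A y -> 0 <= h y) ->
  fine (mup [set a]) * (1 - expR (- h a)) <= fine (mup A) - fine (mum A).
Proof.
move=> mA Aa A0; rewrite !(fine_probD1 _ mA Aa) llr_atom.
have mD : measurable (A `\ a) by exact: measurableD.
have : expR 0 * fine (mum (A `\ a)) <= fine (mup (A `\ a)).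
  by apply: llr_ge => // y [/A0].
rewrite mulrBr mulr1 [X in _ - X]mulrAC -expRD subrr expR0; lra.
Qed.

Lemma Gp_le l : Gp mup h (- l) <= expR (- l) * Gm mum h (- l).
Proof. by apply: llr_le => //; exact: measurable_llr_le. Qed.

Lemma Gm_compl_le l : 1 - Gm mum h (- l) <= expR l * (1 - Gp mup h (- l)).
Proof.
rewrite /Gp /Gm -!fine_probC; [|exact: measurable_llr_le..].
rewrite -(ler_pM2l (expR_gt0 (- l))) mulrA -expRD addNr expR0 mul1r.
apply: llr_ge; first by apply: measurableC; exact: measurable_llr_le.
by move=> y /= /negP; rewrite -ltNge => /ltW.
Qed.

(** The sign condition puts the atom beyond the threshold [- l]: inside [h <= - l] when [0 <= l],
    inside the complement otherwise. On that event the density stays on one side of 1, so the gap is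
    at least the contribution of the atom. *)
Lemma atom_gap a k l : a = h a -> 1 <= `|a| -> `|l| < `|a| ->
  2 ^- k.+2 <= (if a <= 0 then fine (mum [set a]) else fine (mup [set a])) ->
  ((a <= 0) = (0 <= l)) ->
  2 ^- k.+3 <= Gm mum h (- l) - Gp mup h (- l).
Proof.
move=> ha a1 la ak al.
(* The factor [1 - expR (- z)] with [z] the modulus of [a] is thus at least 1/2, which costs the
   step from [k.+2] to [k.+3]. *)
have e2 : expR (- `|a|) <= 2^-1.
  rewrite expRN lef_pV2 ?posrE ?expR_gt0//.
  apply: le_trans (expR_ge1Dx _); lra.
have gap z : 2 ^- k.+2 <= z -> 2 ^- k.+3 <= z * (1 - expR (- `|a|)).
  move=> kz; rewrite exprS invfM mulrC ler_pM// ?invr_ge0 ?exprn_ge0//; lra.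
case: (leP 0 l) al ak => l0 a0; rewrite a0 => ak.
- apply: le_trans (gap _ ak) _; rewrite ler0_norm// opprK [in X in expR X]ha.
  rewrite (ler0_norm a0) (ger0_norm l0) in la.
  apply: llr_gap_le0; first exact: measurable_llr_le.
  + by rewrite /= -ha; lra.
  + by move=> y /=; lra.
- have {}a0 : 0 < a by rewrite ltNge a0.
  apply: le_trans (gap _ ak) _; rewrite gtr0_norm// [in X in expR X]ha.
  rewrite (gtr0_norm a0) (ltr0_norm l0) in la.
  rewrite (_ : Gm _ _ _ - _ = (1 - Gp mup h (- l)) - (1 - Gm mum h (- l))); last lra.
  rewrite /Gp /Gm -!fine_probC; [|exact: measurable_llr_le..].
  apply: llr_gap_ge0; first by apply: measurableC; exact: measurable_llr_le.
  + by rewrite /= -ha; apply/negP; rewrite -ltNge.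
  + by move=> y /= /negP; lra.
Qed.

End LogLikelihoodRatio.

(** * Gap between the action laws, for any version of the log-likelihood ratio *)

Section SignalGap.
Set Implicit Arguments.
Unset Strict Implicit.
Variables (R : realType) (x : nat -> R) (h : R -> R).
Hypothesis x_ge1 : forall k, 1 <= x k.
Hypothesis x_unbounded : forall l, exists k, l < x k.
Local Notation mup := (signal_law x 1 : probability R R).
Local Notation mum := (signal_law x (- 1) : probability R R).
Hypothesis h_llr : is_llr mup mum h.

(** An arbitrary version [h] is fixed only up to null sets, but an atom of positive mass is not
    null, so there [h] must agree with the version [id]. *)
Lemma llr_at_atom k a : a = x k \/ a = - x k -> a = h a.
Proof.
move=> ak; apply: expR_inj.
have mum0 : fine (mum [set a]) != 0.
  have [a0|a0] := leP 0 (- 1 * a).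
    have := @signal_law_atom_ge R x (- 1) k a ak a0.
    rewrite -[X in (_ <= X)%E]fineK ?fin_num_measure// lee_fin => /lt_le_trans.
    by move=> /(_ 0) H; rewrite gt_eqF// H// invr_gt0 exprn_gt0.
  (* For [a > 0] the mass bound concerns [mup]; a null atom of [mum] would make it null for [mup]
     too. *)
  have := @signal_law_atom_ge R x 1 k a ak; rewrite mul1r => /(_ _).
  rewrite mulN1r oppr_lt0 in a0 => /(_ (ltW a0)).
  rewrite -[X in (_ <= X)%E]fineK ?fin_num_measure// lee_fin => /lt_le_trans.
  move=> /(_ 0) H; apply/eqP => m0; move: H.
  rewrite (llr_atom (signal_law_llr x)) m0 mulr0 ltxx => /(_ _).
  by rewrite invr_gt0 exprn_gt0// => /(_ isT).
apply: (mulIf mum0).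
by rewrite -(llr_atom h_llr) (llr_atom (signal_law_llr x)).
Qed.

Lemma signal_gap k l : `|l| < x k ->
  2 ^- k.+3 <= Gm mum h (- l) - Gp mup h (- l).
Proof.
move=> lk; have x0 : 0 < x k by apply: lt_le_trans (x_ge1 k).
have [l0|l0] := leP 0 l.
- apply: (@atom_gap _ _ _ _ h_llr (- x k)); rewrite ?normrN ?(gtr0_norm x0)//.
  + by apply: (@llr_at_atom k); right.
  + rewrite oppr_le0 (ltW x0) -lee_fin fineK ?fin_num_measure//.
    by apply: signal_law_atom_ge; [right|rewrite mulN1r opprK ltW].
  + by rewrite oppr_le0 ltW.
- apply: (@atom_gap _ _ _ _ h_llr (x k)); rewrite ?(gtr0_norm x0)//.
  + by apply: (@llr_at_atom k); left.
  + rewrite (lt_geF x0) -lee_fin fineK ?fin_num_measure//.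
    by apply: signal_law_atom_ge; [left|rewrite mul1r ltW].
  + by rewrite (lt_geF x0) (lt_geF l0).
Qed.

Lemma Gm_gt_Gp l : Gp mup h (- l) < Gm mum h (- l).
Proof.
have [k lk] := x_unbounded `|l|; have := signal_gap lk.
rewrite -subr_gt0; apply: lt_le_trans; by rewrite invr_gt0 exprn_gt0.
Qed.

(** By mutual absolute continuity the event would otherwise be null in both states, against the
    strict gap. Together with [Gm_lt1] this makes all numerators and denominators in [Dp] and [Dm]
    positive, so [ln] and division never take default values. *)
Lemma Gp_gt0 l : 0 < Gp mup h (- l).
Proof.
rewrite lt_neqAle fine_prob_ge0 andbT eq_sym; apply/eqP => p0.
have := Gm_gt_Gp l; rewrite p0 => /gt_eqF/eqP; apply.
have mA := measurable_llr_le h_llr (- l).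
suff m0 : mum [set y | h y <= - l] = 0%E by rewrite /Gm m0.
apply: (signal_law_mutually_ac x 1 mA).1.
by rewrite -[LHS]fineK ?fin_num_measure//; congr (_%:E).
Qed.

Lemma Gm_lt1 l : Gm mum h (- l) < 1.
Proof.
rewrite -subr_gt0 lt_neqAle; apply/andP; split; last first.
  by rewrite subr_ge0; apply: fine_prob_le1; exact: measurable_llr_le h_llr _.
rewrite eq_sym; apply/eqP => p0.
have := Gm_gt_Gp l; have : Gp mup h (- l) = 1; last by lra.
suff : 1 - Gp mup h (- l) = 0 by lra.
have mA := measurable_llr_le h_llr (- l).
rewrite /Gp -fine_probC//.
have mC := measurableC mA.
suff m0 : mup (~` [set y | h y <= - l]) = 0%E by rewrite m0.
apply: (signal_law_mutually_ac x 1 mC).2.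
rewrite -[LHS]fineK ?fin_num_measure//; congr (_%:E).
by apply: etrans p0; exact: fine_probC.
Qed.

Lemma signal_law_unbounded : unbounded_signals mup mum h.
Proof.
move=> M; have mA l := measurable_llr_le h_llr l; split.
- have -> : [set y | M < h y] = ~` [set y | h y <= M].
    by apply/seteqP; split=> y /=; rewrite ltNge => /negP.
  apply: lt_le_trans (leeDr _ _) => //.
  rewrite -[X in (_ < X)%E]fineK ?fin_num_measure//; last exact: measurableC.
  by rewrite lte_fin fine_probC// subr_gt0 -(opprK M) Gm_lt1.
- apply: lt_le_trans (leeDl _ _) => //.
  (* Lowering the threshold by one fits a closed half-line, as in [Gp], inside the open one. *)
  apply: (@lt_le_trans _ _ (mup [set y | h y <= - (M + 1)])).
    by rewrite -[X in (_ < X)%E]fineK ?fin_num_measure// lte_fin; exact: Gp_gt0.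
  apply: le_measure; rewrite ?inE//.
    exact: measurable_llr_lt h_llr _.
  by move=> y /=; lra.
Qed.

End SignalGap.

(** * The Lyapunov functions *)

Section Affinity.
Set Implicit Arguments.
Unset Strict Implicit.
Variable R : realType.
Implicit Types p q d y : R.

Lemma expR_half_lnN y : 0 < y -> expR (- (ln y / 2)) = Num.sqrt y^-1.
Proof.
move=> y0; have y0' : 0 < y^-1 by rewrite invr_gt0.
apply/eqP; rewrite -(@eqrXn2 _ 2)// ?expR_ge0 ?sqrtr_ge0//.
by rewrite sqr_sqrtr ?ltW// -expRM_natl mulrN mulrC divfK// -lnV// lnK.
Qed.

(** Turns a term of the expected Lyapunov factor into a term of the Hellinger affinity. *)
Lemma sqrt_ratio_mul p p' : 0 < p -> 0 < p' ->
  p * Num.sqrt (p / p')^-1 = Num.sqrt p * Num.sqrt p'.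
Proof.
move=> p0 p'0; rewrite invf_div sqrtrM ?sqrtrV ?ltW//.
rewrite -{1}(@sqr_sqrtr _ p) ?ltW//; field.
by rewrite gt_eqF ?sqrtr_gt0.
Qed.

(* With a, b, c, e the square roots of p, p', q, q', the left-hand side is
   ab + ce = 1 - ((a - b)^2 + (c - e)^2) / 2. *)
Lemma affinity_le p p' q q' d : 0 < p -> 0 < p' -> 0 < q -> 0 < q' ->
  p + q = 1 -> p' + q' = 1 -> 0 <= d -> d <= p - p' ->
  p * expR (- (ln (p / p') / 2)) + q * expR (- (ln (q / q') / 2)) <=
  1 - d ^+ 2 / 8.
Proof.
move=> p0 p'0 q0 q'0 pq p'q' d0 dp.
rewrite !expR_half_lnN ?divr_gt0// !sqrt_ratio_mul//.
have sq (z : R) : 0 < z -> Num.sqrt z ^+ 2 = z by move=> z0; rewrite sqr_sqrtr// ltW.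
have := sq _ p0; have := sq _ p'0; have := sq _ q0; have := sq _ q'0.
have := sqrtr_ge0 p; have := sqrtr_ge0 p'.
move: (Num.sqrt p) (Num.sqrt p') (Num.sqrt q) (Num.sqrt q') => a b c e.
move=> b0 a0 eq' cq bp' ap.
have a1 : a <= 1 by rewrite -(@ler_pXn2r _ 2)// ?nnegrE// expr1n; lra.
have b1 : b <= 1 by rewrite -(@ler_pXn2r _ 2)// ?nnegrE// expr1n; lra.
(* Here [p - p' = (a - b) * (a + b)] with [a] and [b] at most 1. Hence [(a - b)^2 / 2] is at least
   [d^2 / 8]. *)
have dab : d <= 2 * (a - b).
  have ab : 0 <= a - b.
    by rewrite subr_ge0 -(@ler_pXn2r _ 2)// ?nnegrE//; lra.
  apply: le_trans dp _; rewrite -ap -bp' subr_sqr mulrC ler_wpM2r//; lra.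
have : d ^+ 2 <= (2 * (a - b)) ^+ 2 by rewrite ler_pXn2r ?nnegrE//; lra.
have := sqr_ge0 (c - e); nra.
Qed.

(** The inequality [1 + z <= expR z] at [z = ln (p' / p)] bounds the logarithm below by
    [(p - p') / p], and [p <= 1]. *)
Lemma ln_ratio_ge p p' : 0 < p' -> p' <= p -> p <= 1 -> p - p' <= ln (p / p').
Proof.
move=> p'0 pp' p1; have p0 : 0 < p by lra.
have r0 : 0 < p' / p by rewrite divr_gt0.
rewrite -[p / p']invf_div lnV ?posrE//.
have := expR_ge1Dx (ln (p' / p)); rewrite lnK ?posrE// => H.
have : p - p' <= 1 - p' / p; last by lra.
rewrite -[X in X - p' / p](@divff _ p) ?gt_eqF// -mulrBl ler_pdivlMr//.
by rewrite ler_piMr// subr_ge0.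
Qed.

End Affinity.

(** * Step size, sign and expected decrease for the public belief *)

Section Belief.
Set Implicit Arguments.
Unset Strict Implicit.
Variables (R : realType) (x : nat -> R) (h : R -> R).
Implicit Type l : R.
Hypothesis x_ge : forall k, (4 * k)%:R + 1 <= x k.
Local Notation mup := (signal_law x 1 : probability R R).
Local Notation mum := (signal_law x (- 1) : probability R R).
Hypothesis h_llr : is_llr mup mum h.

Let x_ge1 k : 1 <= x k.
Proof. by apply: le_trans (x_ge k); rewrite lerDr. Qed.

Let x_unbounded l : exists k, l < x k.
Proof.
exists (Num.truncn `|l|).+1; apply: le_lt_trans (ler_norm l) _.
apply: lt_le_trans (truncnS_gt _) _; apply: le_trans (x_ge _).
by rewrite ler_wpDr// ler_nat leq_pmull.
Qed.

Lemma level_between l : exists2 k, `|l| < x k &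
  forall j, k = j.+1 -> x j <= `|l|.
Proof.
have [k lk mink] := ex_minnP (x_unbounded `|l|).
exists k => // j kj; rewrite leNgt; apply/negP => /mink.
by rewrite kj ltnn.
Qed.

(* For the least such k, either k = 0 or |l| >= x (k - 1) >= 4 (k - 1) + 1. *)
Lemma level_decay l : exists2 k, `|l| < x k &
  expR (- (`|l| / 2)) <= 256 * (2 ^- k.+3) ^+ 2.
Proof.
have [k lk prevk] := level_between l; exists k => //.
have e2 : 2 <= expR (1 : R) by apply: le_trans (expR_ge1Dx _).
case: k lk prevk => [|j] _ prevj.
  apply: (@le_trans _ _ 1); last lra.
  by rewrite expR_le1 oppr_le0 divr_ge0.
have {}prevj := le_trans (x_ge j) (prevj j erefl).
have : expR (- (`|l| / 2)) <= 2 ^- j ^+ 2.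
  apply: (@le_trans _ _ (expR (- (2 * j)%:R))).
    rewrite ler_expR lerN2 ler_pdivlMr// -natrM; apply: le_trans prevj.
    by rewrite ler_wpDr// ler_nat; rewrite mulnC mulnA.
  rewrite expRN -exprVn -exprM exprVn lef_pV2 ?posrE ?expR_gt0 ?exprn_gt0//.
  by rewrite -(mulr1 (2 * j)%:R) expRM_natl mulnC lerXn2r// nnegrE ?expR_ge0.
(* With [k = j + 1], the square of [2 ^- k.+3] is [4^-j / 256], whence the constant. *)
move=> /le_trans; apply; rewrite !exprS !invfM.
have := sqr_ge0 (2 ^- j : R); move: (2 ^- j : R) => z; nra.
Qed.

Lemma Dp_ge k l : `|l| < x k -> 2 ^- k.+3 <= Dp mup mum h l.
Proof.
move=> lk; have := signal_gap x_ge1 h_llr lk.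
have := Gm_lt1 x_ge1 x_unbounded h_llr l.
have := Gp_gt0 x_ge1 x_unbounded h_llr l.
have := Gm_gt_Gp x_ge1 x_unbounded h_llr l.
rewrite /Dp.
move: (Gp mup h (- l)) (Gm mum h (- l)) => q q' gap q0 q'1 d.
apply: le_trans (@ln_ratio_ge _ _ _ _ _ _); lra.
Qed.

Lemma Dm_le k l : `|l| < x k -> Dm mup mum h l <= - 2 ^- k.+3.
Proof.
move=> lk; have := signal_gap x_ge1 h_llr lk.
have := Gm_lt1 x_ge1 x_unbounded h_llr l.
have := Gp_gt0 x_ge1 x_unbounded h_llr l.
have := Gm_gt_Gp x_ge1 x_unbounded h_llr l.
rewrite /Dm.
move: (Gp mup h (- l)) (Gm mum h (- l)) => q q' gap q0 q'1 d.
have q'0 : 0 < q' by lra.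
rewrite lerNr -lnV ?posrE ?divr_gt0// invf_div.
apply: le_trans (@ln_ratio_ge _ _ _ _ _ _); lra.
Qed.

(** On [h > - l] the density is at least [expR (- l)], hence [Dp] is at least [- l]: a single action
    overturns any opposing belief. *)
Lemma belief_after_up l : 0 <= l + Dp mup mum h l.
Proof.
have := Gm_lt1 x_ge1 x_unbounded h_llr l.
have := Gm_gt_Gp x_ge1 x_unbounded h_llr l.
have := Gm_compl_le h_llr l; rewrite /Dp.
move: (Gp mup h (- l)) (Gm mum h (- l)) => q q' le gap m1.
suff : - l <= ln ((1 - q) / (1 - q')) by lra.
rewrite -ler_expR lnK ?posrE ?divr_gt0//; [|lra..].
rewrite ler_pdivlMr; last lra.
by rewrite -(ler_pM2l (expR_gt0 l)) mulrA -expRD subrr expR0 mul1r.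
Qed.

Lemma belief_after_down l : l + Dm mup mum h l <= 0.
Proof.
have := Gp_gt0 x_ge1 x_unbounded h_llr l.
have := Gm_gt_Gp x_ge1 x_unbounded h_llr l.
have := Gp_le h_llr l; rewrite /Dm.
move: (Gp mup h (- l)) (Gm mum h (- l)) => q q' le gap q0.
have q'0 : 0 < q' by lra.
suff : ln (q / q') <= - l by lra.
by rewrite -ler_expR lnK ?posrE ?divr_gt0// ler_pdivrMr.
Qed.

(** After factoring out [V = expR (- (l / 2))], the affinity bound leaves a decrease of
    [V * d^2 / 8] with [d = 2 ^- k.+3]. The error probability is at most [256 * V * d^2] by
    [level_decay], and [2048 = 8 * 256]. *)
Lemma lyapunov_up l :
  (1 - Gp mup h (- l)) * expR (- ((l + Dp mup mum h l) / 2)) +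
  Gp mup h (- l) * expR (- ((l + Dm mup mum h l) / 2)) +
  Gp mup h (- l) / 2048 <= expR (- (l / 2)).
Proof.
have := Gm_lt1 x_ge1 x_unbounded h_llr l.
have := Gp_gt0 x_ge1 x_unbounded h_llr l.
have := Gm_gt_Gp x_ge1 x_unbounded h_llr l.
have := Gp_le h_llr l.
have [k lk dec] := level_decay l.
have := signal_gap x_ge1 h_llr lk.
rewrite /Dp /Dm.
move: (Gp mup h (- l)) (Gm mum h (- l)) => q q' gap qle qq' q0 q'1.
have d0 : 0 <= 2 ^- k.+3 :> R by rewrite invr_ge0 exprn_ge0.
rewrite !(mulrDl l) !opprD !expRD ![_ * (expR (- (l / 2)) * _)]mulrCA -mulrDr.
have := @affinity_le R (1 - q) (1 - q') q q' (2 ^- k.+3).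
move=> /(_ _ _ _ _ _ _ d0 _) aff.
have {}aff := aff ltac:(lra) ltac:(lra) ltac:(lra) ltac:(lra) ltac:(lra)
  ltac:(lra) ltac:(lra).
(* For [0 <= l] the product is [expR (- l)] and [Gp_le] applies; for [l < 0] it is 1. *)
have qV : q <= expR (- (l / 2)) * expR (- (`|l| / 2)).
  rewrite -expRD; have [l0|l0] := leP 0 l.
    rewrite ger0_norm// (_ : - (l / 2) - l / 2 = - l); last by field.
    apply: le_trans qle _; rewrite ler_piMr ?expR_ge0//; lra.
  by rewrite ltr0_norm// mulNr opprK addNr expR0; lra.
have V0 := expR_gt0 (- (l / 2)).
have := ler_wpM2l (ltW V0) aff; have := ler_wpM2l (ltW V0) dec.
move: (expR (- (l / 2))) (expR (- (`|l| / 2))) qV => V W qV; lra.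
Qed.

Lemma lyapunov_down l :
  (1 - Gm mum h (- l)) * expR ((l + Dp mup mum h l) / 2) +
  Gm mum h (- l) * expR ((l + Dm mup mum h l) / 2) +
  (1 - Gm mum h (- l)) / 2048 <= expR (l / 2).
Proof.
have := Gm_lt1 x_ge1 x_unbounded h_llr l.
have := Gp_gt0 x_ge1 x_unbounded h_llr l.
have := Gm_gt_Gp x_ge1 x_unbounded h_llr l.
have := Gm_compl_le h_llr l.
have [k lk dec] := level_decay l.
have := signal_gap x_ge1 h_llr lk.
rewrite /Dp /Dm.
move: (Gp mup h (- l)) (Gm mum h (- l)) => q q' gap qle qq' q0 q'1.
have d0 : 0 <= 2 ^- k.+3 :> R by rewrite invr_ge0 exprn_ge0.
(* Inverting the ratios turns the positive exponents into those of [affinity_le], with the roles of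
   the two states exchanged. *)
have lnd (u v : R) : 0 < u -> 0 < v -> ln (u / v) / 2 = - (ln (v / u) / 2).
  by move=> u0 v0; rewrite -mulNr -lnV ?posrE ?divr_gt0// invf_div.
rewrite !(mulrDl l) !expRD ![_ * (expR (l / 2) * _)]mulrCA -mulrDr.
rewrite (lnd (1 - q) (1 - q')) ?(lnd q q'); [|lra..].
have := @affinity_le R q' q (1 - q') (1 - q) (2 ^- k.+3).
move=> /(_ _ _ _ _ _ _ d0 _) aff.
have {}aff := aff ltac:(lra) ltac:(lra) ltac:(lra) ltac:(lra) ltac:(lra)
  ltac:(lra) ltac:(lra).
have qV : 1 - q' <= expR (l / 2) * expR (- (`|l| / 2)).
  rewrite -expRD; have [l0|l0] := leP 0 l.
    by rewrite ger0_norm// subrr expR0; lra.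
  rewrite ltr0_norm// mulNr opprK (_ : l / 2 + l / 2 = l); last by field.
  apply: le_trans qle _; rewrite ler_piMr ?expR_ge0//; lra.
have V0 := expR_gt0 (l / 2).
have := ler_wpM2l (ltW V0) aff; have := ler_wpM2l (ltW V0) dec.
move: (expR (l / 2)) (expR (- (`|l| / 2))) qV => V W qV; lra.
Qed.

End Belief.

(** * Finitely many errors *)

Section FinitelyManyErrors.
Set Implicit Arguments.
Unset Strict Implicit.
Variables (R : realType) (h up down : R -> R).

Definition belief_step (l y : R) : R := if 0 < l + h y then up l else down l.

(** Unlike [pub_llr], this recursion consumes the first signal first and starts anywhere, as needed
    for an induction that splits on the next action. *)
Fixpoint belief (l : R) (sig : nat -> R) (n : nat) : R :=
  if n is n'.+1 then belief (belief_step l (sig 0%N)) (fun k => sig k.+1) n'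
  else l.

Lemma beliefSr l sig n :
  belief l sig n.+1 = belief_step (belief l sig n) (sig n).
Proof. by elim: n l sig => // n IH l sig; rewrite /= -IH. Qed.

Definition acts (b : bool) (l : R) : set R := [set y | (0 < l + h y) = b].

Hypothesis mh : measurable_fun setT h.

Lemma measurable_acts b l : measurable (acts b l).
Proof.
have mu : measurable [set y | 0 < l + h y].
  rewrite (_ : [set y | _] = setT `&` h @^-1` `]- l, +oo[); first exact: mh.
  rewrite setTI; apply/seteqP; split=> y /=; rewrite in_itv/= andbT; lra.
case: b; first exact: mu.
rewrite (_ : acts false l = ~` [set y | 0 < l + h y]); first exact: measurableC.
by apply/seteqP; split=> y; rewrite /acts /=; [move=> ->|move=> /negP/negPf].
Qed.

Variables (d : measure_display) (Omega : measurableType d).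
Variables (P : probability Omega R) (s : nat -> Omega -> R) (Theta : set Omega).
Hypothesis ms : forall t, measurable_fun setT (s t).
Hypothesis mTheta : measurable Theta.

Definition cylinder (m : nat) (A : nat -> set R) : set Omega :=
  Theta `&` \bigcap_(i in `I_m) (s i @^-1` A i).

(** The belief is restarted at [l] once [m] signals are spent, so the event depends on the signals
    from index [m] on only. *)
Definition act_at (b : bool) (m : nat) (l : R) (n : nat) : set Omega :=
  [set w | acts b (belief l (fun k => s (m + k)%N w) n) (s (m + n)%N w)].

Lemma measurable_signal t B : measurable B -> measurable (s t @^-1` B).
Proof. by move=> mB; rewrite -[X in measurable X]setTI; exact: ms. Qed.

Lemma measurable_cylinder m A : (forall i, measurable (A i)) ->
  measurable (cylinder m A).
Proof.
move=> mA; apply: measurableI => //; apply: bigcap_measurableType => // i _.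
 exact: measurable_signal.
Qed.

Lemma act_at0 b m l : act_at b m l 0 = s m @^-1` acts b l.
Proof. by apply/seteqP; split=> w; rewrite /act_at /= addn0. Qed.

Lemma act_atS b m l n : act_at b m l n.+1 =
  (s m @^-1` acts true l `&` act_at b m.+1 (up l) n) `|`
  (s m @^-1` acts false l `&` act_at b m.+1 (down l) n).
Proof.
have shift w : (fun k => s (m + k.+1)%N w) = (fun k => s (m.+1 + k)%N w).
  by apply/funext => k; rewrite addnS.
apply/seteqP; split=> w; rewrite /act_at /= addn0 shift addnS /belief_step.
  by rewrite {1 3}/acts /=; case: ifP => lw; [left|right].
by rewrite {1 3}/acts /=; case=> -[->].
Qed.

Lemma measurable_act_at b m l n : measurable (act_at b m l n).
Proof.
elim: n m l => [|n IH] m l.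
  by rewrite act_at0; apply: measurable_signal; exact: measurable_acts.
rewrite act_atS; apply: measurableU; apply: measurableI => //;
  by apply: measurable_signal; exact: measurable_acts.
Qed.

Definition extend (m : nat) (A : nat -> set R) (B : set R) (i : nat) : set R :=
  if (i < m)%N then A i else B.

Lemma cylinder_extend m A B :
  cylinder m.+1 (extend m A B) = cylinder m A `&` s m @^-1` B.
Proof.
apply/seteqP; split=> w; rewrite /cylinder /extend /bigcap /=.
  move=> [Tw Aw]; split; last by have := Aw m (ltnSn m); rewrite ltnn.
  by split=> // i im; have := Aw i (ltnW im); rewrite im.
move=> [[Tw Aw] Bw]; split=> // i; rewrite ltnS leq_eqVlt.
by case/predU1P=> [->|im]; rewrite ?ltnn ?im//; exact: Aw.
Qed.

Variable nu : probability R R.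
Hypothesis iid : forall n (A : nat -> set R), (forall i, measurable (A i)) ->
  P (cylinder n A) = ((2^-1)%:E * \big[*%E/1%E]_(i < n) nu (A i))%E.

(** Independence enters here: the next signal factors out of a cylinder over the past. *)
Lemma fine_cylinder_extend m A B : (forall i, measurable (A i)) ->
  measurable B ->
  fine (P (cylinder m.+1 (extend m A B))) =
  fine (P (cylinder m A)) * fine (nu B).
Proof.
move=> mA mB; have mE i : measurable (extend m A B i).
  by rewrite /extend; case: ifP.
rewrite -fineM ?fin_num_measure//; last exact: measurable_cylinder.
rewrite !iid// big_ord_recr/= /extend ltnn muleA; congr (fine (_ * _ * _)).
by apply: eq_bigr => i _; rewrite ltn_ord.
Qed.

Variables (b : bool) (V : R -> R) (c : R).
Hypothesis V_ge0 : forall l, 0 <= V l.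
Hypothesis c_gt0 : 0 < c.
Hypothesis lyapunov : forall l,
  fine (nu (acts true l)) * V (up l) + fine (nu (acts false l)) * V (down l) +
  fine (nu (acts b l)) * c <= V l.

(** Scaled by the mass of the past cylinder, [lyapunov] pays for the action at [m]; the induction
    hypothesis on the two one-signal extensions, restarted at [up l] and [down l], pays for the
    later ones. Cylinders thus take the place of conditional expectations. *)
Lemma sum_act_at_le N m A l : (forall i, measurable (A i)) ->
  c * \sum_(n < N) fine (P (cylinder m A `&` act_at b m l n)) <=
  fine (P (cylinder m A)) * V l.
Proof.
elim: N m A l => [|N IH] m A l mA.
  by rewrite big_ord0 mulr0 mulr_ge0// fine_ge0.
have mE B : measurable B -> forall i, measurable (extend m A B i).
  by move=> mB i; rewrite /extend; case: ifP.
have mC := measurable_cylinder m mA.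
rewrite big_ord_recl act_at0 -cylinder_extend fine_cylinder_extend//; last first.
  exact: measurable_acts.
set S := \sum_(i < N) _; set Q := fine (P (cylinder m A)).
have Q0 : 0 <= Q by exact: fine_ge0.
have IHu := IH m.+1 (extend m A (acts true l)) (up l) (mE _ (measurable_acts _ _)).
have IHd := IH m.+1 (extend m A (acts false l)) (down l) (mE _ (measurable_acts _ _)).
rewrite !fine_cylinder_extend// in IHu IHd; [|exact: measurable_acts..].
have SS : S <=
    \sum_(n < N) fine (P (cylinder m.+1 (extend m A (acts true l)) `&`
                          act_at b m.+1 (up l) n)) +
    \sum_(n < N) fine (P (cylinder m.+1 (extend m A (acts false l)) `&`
                          act_at b m.+1 (down l) n)).
  rewrite -big_split/=; apply: ler_sum => n _.
  rewrite !cylinder_extend act_atS setIUr !setIA.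
  have mI b' l' : measurable (cylinder m A `&` s m @^-1` acts b' l `&`
                              act_at b m.+1 l' n).
    apply: measurableI; last exact: measurable_act_at.
    by apply: measurableI => //; apply: measurable_signal; exact: measurable_acts.
  rewrite -fineD ?fin_num_measure//; apply: fine_le.
  - by rewrite fin_num_measure//; exact: measurableU.
  - by rewrite fin_numD !fin_num_measure.
  - exact: measureU2.
have := ler_wpM2l (ltW c_gt0) SS; rewrite mulrDr => cS.
have := ler_wpM2l Q0 (lyapunov l); rewrite -/Q in IHu IHd.
move: IHu IHd cS; lra.
Qed.

(** The error probabilities sum to at most [V 0 / c], so Borel-Cantelli applies. *)
Lemma act_at_io_null :
  P (lim_sup_set (fun n => Theta `&` act_at b 0 0 n)) = 0%E.
Proof.
have mE n : measurable (Theta `&` act_at b 0 0 n).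
  by apply: measurableI => //; exact: measurable_act_at.
apply: lim_sup_set_cvg0 => //.
apply: (@le_lt_trans _ _ ((V 0 / c)%:E)); last exact: ltry.
apply: lime_le; first exact: is_cvg_nneseries.
apply: nearW => N; rewrite big_mkord.
rewrite (eq_bigr (fun n : 'I_N => (fine (P (Theta `&` act_at b 0 0 n)))%:E)); last first.
  by move=> n _; rewrite fineK// fin_num_measure.
rewrite sumEFin lee_fin ler_pdivlMr// mulrC.
have := @sum_act_at_le N 0 (fun=> setT) 0 (fun=> measurableT).
have -> : cylinder 0 (fun=> setT) = Theta.
  by apply/seteqP; split=> w; rewrite /cylinder /bigcap //= => -[].
move=> /le_trans; apply.
rewrite ler_piMl// -lee_fin fineK ?fin_num_measure//.
exact: probability_le1.
Qed.

End FinitelyManyErrors.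

(** * Growth of the public belief *)

Section Growth.
Set Implicit Arguments.
Unset Strict Implicit.
Variable R : realType.

Lemma limn_einf_gt0 (u : nat -> R) (a : R) (T : nat) : 0 < a ->
  (forall t, (T <= t)%N -> a <= u t) -> (0 < limn_einf (fun t => (u t)%:E))%E.
Proof.
move=> a0 au; apply: (@lt_le_trans _ _ a%:E); first by rewrite lte_fin.
rewrite limn_einf_lim.
have /cvg_lim -> // := @cvg_einfs_sup R (fun t => (u t)%:E).
apply: le_trans (ereal_sup_ubound _); last by exists T.
by apply: le_ereal_inf_tmp => _ [t /= Tt <-]; rewrite lee_fin au.
Qed.

Variables (r : nat -> R) (N : nat -> nat).
Hypothesis r_gt0 : forall t, 0 < r t.
Hypothesis r_le : forall k n, (N k <= n)%N -> r n <= 2 ^- k.+3 * n%:R.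

(** The first summands serve [level_decay]. The sum of positive terms stands for a maximum: it
    dominates every [r t] with [t < N k.+1]. *)
Definition level (k : nat) : R := (4 * k)%:R + 1 + \sum_(i < N k.+1) r i.

Lemma level_ge k : (4 * k)%:R + 1 <= level k.
Proof. by rewrite lerDl sumr_ge0// => i _; exact: ltW. Qed.

Lemma r_le_level k t : (t < N k.+1)%N -> r t <= level k.
Proof.
move=> tN; rewrite /level (bigD1 (Ordinal tN))//=.
have : 0 <= \sum_(i < N k.+1 | i != Ordinal tN) r i.
  by rewrite sumr_ge0// => i _; exact: ltW.
have : 0 <= (4 * k)%:R :> R by [].
lra.
Qed.

(** Take the least level [k] above [m t]. If [N k <= t.+1], linear growth at rate [2 ^- k.+3] beats
    half of [r t.+1]; otherwise [k = j + 1] and [m t] has already passed [level j], which dominates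
    [r t.+1]. *)
Lemma growth_ge (m : nat -> R) (T : nat) :
  (forall t, (T <= t)%N -> 0 <= m t) ->
  (forall t k, (T <= t)%N -> m t < level k -> m t + 2 ^- k.+3 <= m t.+1) ->
  exists T', forall t, (T' <= t)%N -> 2^-1 <= m t / r t.+1.
Proof.
move=> m0 mS.
(* Each increment is positive, so being below [level k] now implies it at all times since [T]. *)
have linear k n : m (T + n)%N < level k -> 2 ^- k.+3 * n%:R <= m (T + n)%N.
  elim: n => [|n IH]; first by rewrite mulr0 addn0 m0.
  have Tn := leq_addr n T; rewrite addnS => lk.
  have [j mj _] := level_between level_ge (m (T + n)%N).
  rewrite ger0_norm ?m0// in mj.
  have d0 : 0 <= 2 ^- j.+3 :> R by rewrite invr_ge0 exprn_ge0.
  have mk : m (T + n)%N < level k by have := mS _ _ Tn mj; lra.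
  have := mS _ _ Tn mk; have := IH mk.
  by rewrite -(natr1 n) mulrDr mulr1; lra.
(* The term [2 * T] ensures [t.+1 <= 2 * (t - T)], and [N 0] rules out [k = 0] when [t.+1 < N k]. *)
exists (2 * T + N 0%N).+1 => t Tt.
have tT : (T <= t)%N by lia.
rewrite ler_pdivlMr//.
have [k mk prev] := level_between level_ge (m t).
rewrite ger0_norm ?m0// in mk prev.
have [Nt|tN] := leqP (N k) t.+1; last first.
  case: k mk prev tN => [|j] mk prev tN; first by move: tN; lia.
  have := r_le_level tN; have := prev _ erefl; have := r_gt0 t.+1; lra.
have := linear k (t - T)%N; rewrite subnKC// => /(_ mk).
have := r_le Nt.
have d0 : 0 <= 2 ^- k.+3 :> R by rewrite invr_ge0 exprn_ge0.
have : t.+1%:R <= 2 * (t - T)%:R :> R by rewrite -natrM ler_nat; lia.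
move: (t.+1%:R) ((t - T)%:R) => a b ab ra mb.
have := ler_wpM2l d0 ab; lra.
Qed.

End Growth.

(** * Almost sure growth in the model *)

Lemma pub_llr_belief (R : realType) (mup mum : probability R R) (h : R -> R)
    (sig : nat -> R) (t : nat) :
  pub_llr mup mum h sig t =
  belief h (fun l => l + Dp mup mum h l) (fun l => l + Dm mup mum h l) 0 sig t.
Proof. by elim: t => // t IH; rewrite beliefSr /= IH. Qed.

Lemma notin_lim_sup_set {T : Type} {F : nat -> set T} {w} :
  ~ lim_sup_set F w -> exists n, forall j, (n <= j)%N -> ~ F j w.
Proof.
move=> /existsNP[n /not_implyP[_ Fn]]; exists n => j nj Fj.
by apply: Fn; exists j.
Qed.

Theorem theorem2 (R : realType) (r : nat -> R)
  (r_pos : forall t, 0 < r t)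
  (r_sublin : (fun t : nat => r t / t%:R) @ \oo --> (0 : R)) :
  exists mup mum : probability R R,
    mutually_ac mup mum /\
    (exists h, is_llr mup mum h) /\
    forall h : R -> R, is_llr mup mum h ->
      unbounded_signals mup mum h /\
      forall (d : measure_display) (Omega : measurableType d)
             (P : probability Omega R) (theta : Omega -> bool)
             (s : nat -> Omega -> R),
        social_model mup mum P theta s ->
        {ae P, forall w,
          (0 < limn_einf (fun t : nat =>
                 ((`| pub_llr mup mum h (fun k => s k w) t |) / r t.+1)%:E))%E}.
Proof.
have /choice[N r_le] k : exists N, forall n, (N <= n)%N ->
    r n <= 2 ^- k.+3 * n%:R.
  have d0 : 0 < 2 ^- k.+3 :> R by rewrite invr_gt0 exprn_gt0.
  have /cvgrPdist_le/(_ _ d0)[M _ rM] := r_sublin.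
  (* The successor keeps [n] positive, so that the quotient by [n] is genuine. *)
  exists M.+1 => n Mn; have n0 : 0 < n%:R :> R by rewrite ltr0n; lia.
  have := rM n (ltnW Mn); rewrite /= sub0r normrN ger0_norm ?ler_pdivrMr//.
  by rewrite divr_ge0// ltW.
pose x := level r N; have x_ge := level_ge N r_pos.
have x_ge1 k : 1 <= x k by apply: le_trans (x_ge k); rewrite lerDr.
have x_unbounded l : exists k, l < x k.
  have [k lk _] := level_between x_ge l.
  by exists k; apply: le_lt_trans lk; exact: ler_norm.
exists (signal_law x 1), (signal_law x (- 1)); split.
  exact: signal_law_mutually_ac.
split; first by exists id; exact: signal_law_llr.
move=> h h_llr; split; first exact: signal_law_unbounded.
move=> d Omega P theta s [mtheta [ms model]].
set mup := signal_law x 1; set mum := signal_law x (- 1).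
pose up l := l + Dp mup mum h l; pose down l := l + Dm mup mum h l.
have mtheta' : measurable [set w | ~~ theta w].
  rewrite (_ : [set w | _] = ~` [set w | theta w]); first exact: measurableC.
  by apply/seteqP; split=> w /= /negP.
have acts_down l : acts h false l = [set y | h y <= - l].
  by apply/seteqP; split=> y; rewrite /acts/=; lra.
have acts_up l : acts h true l = ~` [set y | h y <= - l].
  by apply/seteqP; split=> y; rewrite /acts/=; lra.
have m_le l : measurable [set y | h y <= l].
  exact: measurable_llr_le h_llr l.
have c0 : 0 < 2048^-1 :> R by lra.
(* An error in the high state is the action [false], of probability [Gp] at [- l]; in the low state
   it is [true]. *)
have up_null : P (lim_sup_set (fun n => [set w | theta w] `&`
    act_at h up down s false 0 0 n)) = 0%E.
  apply: (@act_at_io_null R h up down h_llr.1 d Omega P s _ ms mtheta mup _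
    false (fun l => expR (- (l / 2))) 2048^-1 _ c0).
  - by move=> n A mA; exact: (model n A mA).1.
  - by move=> l; exact: expR_ge0.
  - move=> l; rewrite acts_up acts_down fine_probC//.
    exact: (lyapunov_up x_ge h_llr l).
have down_null : P (lim_sup_set (fun n => [set w | ~~ theta w] `&`
    act_at h up down s true 0 0 n)) = 0%E.
  apply: (@act_at_io_null R h up down h_llr.1 d Omega P s _ ms mtheta' mum _
    true (fun l => expR (l / 2)) 2048^-1 _ c0).
  - by move=> n A mA; exact: (model n A mA).2.
  - by move=> l; exact: expR_ge0.
  - move=> l; rewrite acts_up acts_down fine_probC//.
    exact: (lyapunov_down x_ge h_llr l).
have m_act b n : measurable (act_at h up down s b 0 0 n).
  by apply: measurable_act_at => //; exact: h_llr.1.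
have m_sup (F : nat -> set Omega) : (forall n, measurable (F n)) ->
    measurable (lim_sup_set F).
  move=> mF; apply: bigcap_measurable; first by exists 0%N.
  by move=> n _; apply: bigcup_measurable.
have mU := m_sup _ (fun n => measurableI _ _ mtheta (m_act false n)).
have mD := m_sup _ (fun n => measurableI _ _ mtheta' (m_act true n)).
have nU := proj2 (negligibleP P mU) up_null.
have nD := proj2 (negligibleP P mD) down_null.
(* Off the two null sets, all actions are correct from some time on, whichever state holds. *)
apply: negligibleS (negligibleU nU nD) => w /= nw; apply: contrapT => /not_orP[/notin_lim_sup_set[T wT]].
move=> /notin_lim_sup_set[T' wT']; apply: nw.
pose ell := pub_llr mup mum h (fun k => s k w).
have ellE t : ell t = belief h up down 0 (fun k => s k w) t.
  exact: pub_llr_belief.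
have ellS t : ell t.+1 =
    if 0 < ell t + h (s t w) then up (ell t) else down (ell t) by [].
suff [T0 mS] : exists T0, forall t k, (T0 <= t)%N -> `|ell t| < x k ->
    `|ell t| + 2 ^- k.+3 <= `|ell t.+1|.
  have [T1 mT1] := growth_ge r_pos r_le (fun t _ => normr_ge0 (ell t)) mS.
  by apply: (@limn_einf_gt0 _ _ 2^-1 T1); rewrite ?invr_gt0.
have [tw|tw] := boolP (theta w).
- have goup t : (T <= t)%N -> ell t.+1 = up (ell t).
    move=> Tt; rewrite ellS; case: ifPn => // /negPf nup.
    by case: (wT t Tt); split=> //; rewrite /act_at /acts/= -ellE.
  (* The inequality on [t] is strict because the sign is known only after one correct action. *)
  have ell0 t : (T < t)%N -> 0 <= ell t.
    by case: t => // t Tt; rewrite goup//; exact: belief_after_up x_ge h_llr _.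
  exists T.+1 => t k Tt lk.
  have := Dp_ge x_ge h_llr lk.
  rewrite !ger0_norm ?ell0//; last exact: ltnW.
  by rewrite goup ?(ltnW Tt)// /up; lra.
- have godown t : (T' <= t)%N -> ell t.+1 = down (ell t).
    move=> Tt; rewrite ellS; case: ifPn => // nup.
    by case: (wT' t Tt); split=> //; rewrite /act_at /acts/= -ellE.
  have ell0 t : (T' < t)%N -> ell t <= 0.
    by case: t => // t Tt; rewrite godown//; exact: belief_after_down x_ge h_llr _.
  exists T'.+1 => t k Tt lk.
  have := Dm_le x_ge h_llr lk.
  rewrite !ler0_norm ?ell0//; last exact: ltnW.
  by rewrite godown ?(ltnW Tt)// /down; lra.
Qed.
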